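(* Let $w := (w_n)_{n \in \mathbb{Z}}$ be a bounded sequence of nonzero scalars in $\mathbb{K}$. The bilateral weighted backward shift $$B_w : (x_n)_{n \in \mathbb{Z}} \in c_0(\mathbb{Z}) \mapsto (w_n x_{n+1})_{n \in \mathbb{Z}} \in c_0(\mathbb{Z})$$ is Li-Yorke chaotic if and only if the following conditions hold: (a) $\displaystyle \liminf_{n \to \infty} |w_{-n} \cdots w_{-1}| = 0$. (b) $\sup\{|w_i \cdots w_j| : i,j \in \mathbb{Z}, i \leq j\} = \infty$.
   Context: $\mathbb{K}$ denotes $\mathbb{R}$ or $\mathbb{C}$. $c_0(\mathbb{Z})$ is the Banach space of families $(x_n)_{n\in\mathbb{Z}}$ in $\mathbb{K}$ with $x_n \to 0$ as $|n| \to \infty$, with the supremum norm. For $i \leq j$, $w_i\cdots w_j$ denotes the product of all $w_l$ with $i \leq l \leq j$. A continuous map $g : M \to M$ on a metric space $(M,d)$ is Li-Yorke chaotic if there is an uncountable set $S \subset M$ such that for all distinct $x,y \in S$, $\liminf_{n \to \infty} d(g^n(x),g^n(y)) = 0$ and $\limsup_{n\to\infty} d(g^n(x),g^n(y)) > 0$. *)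

(* Defs.v *)
From Stdlib Require Import Reals ZArith List Lra Lia.
From Stdlib Require Import FunctionalExtensionality ProofIrrelevance.
From Coquelicot Require Import Coquelicot.
Open Scope R_scope.

Record continuous_self_map (M : Metric_Space) := {
  self_map :> Base M -> Base M;
  self_map_continuous :
    forall x : Base M, limit_in M M self_map (fun _ => True) x (self_map x)
}.

Definition countable {T : Type} (S : T -> Prop) : Prop :=
  exists f : T -> nat, forall x y, S x -> S y -> f x = f y -> x = y.

Definition li_yorke_chaotic (M : Metric_Space) (g : continuous_self_map M) :
    Prop :=
  exists S : Base M -> Prop,
    ~ countable S /\
    forall x y, S x -> S y -> x <> y ->
      LimInf_seq (fun n => dist M (Nat.iter n g x) (Nat.iter n g y)) = 0 /\
      Rbar_lt 0 (LimSup_seq (fun n => dist M (Nat.iter n g x) (Nat.iter n g y))).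

Section C0.

Context {K : AbsRing}.

Definition bounded_family (u : Z -> K) : Prop :=
  exists M : R, forall n, abs (u n) <= M.

Definition vanishes_at_infinity (u : Z -> K) : Prop :=
  forall eps : R, 0 < eps ->
    exists N : Z, forall n : Z, (N <= Z.abs n)%Z -> abs (u n) < eps.

(* Meaningful for bounded families only: [real] sends an infinite supremum
   to 0. *)
Definition sup_norm (u : Z -> K) : R :=
  real (Lub_Rbar (fun r => exists n : Z, r = abs (u n))).

Lemma sup_norm_ub (u : Z -> K) (n : Z) :
  bounded_family u -> abs (u n) <= sup_norm u.
Proof.
intros [M HM]; unfold sup_norm.
destruct (Lub_Rbar_correct (fun r => exists n : Z, r = abs (u n))) as [H1 H2].
assert (Ha := H1 _ (ex_intro _ n eq_refl)).
assert (Hb : Rbar_le (Lub_Rbar (fun r => exists n : Z, r = abs (u n))) M)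
  by (apply H2; intros r [m ->]; apply HM).
destruct (Lub_Rbar _); simpl in *; tauto || assumption.
Qed.

Lemma sup_norm_le (u : Z -> K) (M : R) :
  (forall n, abs (u n) <= M) -> sup_norm u <= M.
Proof.
intros HM; unfold sup_norm.
destruct (Lub_Rbar_correct (fun r => exists n : Z, r = abs (u n))) as [H1 H2].
assert (Ha := H1 _ (ex_intro _ 0%Z eq_refl)).
assert (Hb : Rbar_le (Lub_Rbar (fun r => exists n : Z, r = abs (u n))) M)
  by (apply H2; intros r [m ->]; apply HM).
destruct (Lub_Rbar _); simpl in *; tauto || assumption.
Qed.

Lemma vanishes_bounded (u : Z -> K) :
  vanishes_at_infinity u -> bounded_family u.
Proof.
intros Hu.
destruct (Hu 1 Rlt_0_1) as [N HN].
assert (H : forall k : nat, exists M : R,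
  forall n, (Z.abs n < Z.of_nat k)%Z -> abs (u n) <= M).
{ induction k as [|k [M HM]].
  - exists 0; intros n Hn; lia.
  - exists (Rmax M (Rmax (abs (u (Z.of_nat k))) (abs (u (- Z.of_nat k)%Z)))).
    intros n Hn.
    destruct (Z_lt_dec (Z.abs n) (Z.of_nat k)) as [Hk|Hk].
    + apply Rle_trans with (1 := HM n Hk), Rmax_l.
    + eapply Rle_trans; [|apply Rmax_r].
      assert (E : n = Z.of_nat k \/ n = (- Z.of_nat k)%Z) by lia.
      destruct E as [-> | ->]; [apply Rmax_l | apply Rmax_r]. }
destruct (H (Z.to_nat N)) as [M HM].
exists (Rmax M 1); intros n.
destruct (Z_lt_dec (Z.abs n) N) as [Hn|Hn].
- eapply Rle_trans; [apply HM; lia | apply Rmax_l].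
- eapply Rle_trans; [apply Rlt_le, HN; lia | apply Rmax_r].
Qed.

Lemma vanishes_minus (u v : Z -> K) :
  vanishes_at_infinity u -> vanishes_at_infinity v ->
  vanishes_at_infinity (fun n => minus (u n) (v n)).
Proof.
intros Hu Hv eps He.
destruct (Hu (eps / 2)) as [N1 H1]; [lra|].
destruct (Hv (eps / 2)) as [N2 H2]; [lra|].
exists (Z.max N1 N2); intros n Hn.
assert (A1 := H1 n ltac:(lia)); assert (A2 := H2 n ltac:(lia)).
apply Rle_lt_trans with (1 := abs_triangle _ _).
rewrite abs_opp, <- (Rplus_half_diag eps); apply Rplus_lt_compat; assumption.
Qed.

End C0.

Definition c0 (K : AbsRing) : Type := {x : Z -> K | vanishes_at_infinity x}.

Definition c0_coord {K : AbsRing} (x : c0 K) : Z -> K := proj1_sig x.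

Definition c0_dist {K : AbsRing} (x y : c0 K) : R :=
  sup_norm (fun n => minus (c0_coord x n) (c0_coord y n)).

Section C0Metric.

Context {K : AbsRing}.

Lemma c0_coord_dist (x y : c0 K) (n : Z) :
  abs (minus (c0_coord x n) (c0_coord y n)) <= c0_dist x y.
Proof.
apply (sup_norm_ub (fun n => minus (c0_coord x n) (c0_coord y n))).
apply vanishes_bounded, vanishes_minus; [apply (proj2_sig x) | apply (proj2_sig y)].
Qed.

Lemma c0_dist_pos (x y : c0 K) : c0_dist x y >= 0.
Proof.
apply Rle_ge; eapply Rle_trans; [|apply (c0_coord_dist x y 0%Z)].
apply abs_ge_0.
Qed.

Lemma c0_dist_sym (x y : c0 K) : c0_dist x y = c0_dist y x.
Proof.
apply Rle_antisym; apply sup_norm_le; intros n; rewrite abs_minus;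
  apply c0_coord_dist.
Qed.

Lemma c0_dist_refl (x y : c0 K) : c0_dist x y = 0 <-> x = y.
Proof.
split.
- intros H; destruct x as [x Hx], y as [y Hy].
  assert (E : x = y).
  { apply functional_extensionality; intros n.
    assert (A : abs (minus (x n) (y n)) <= 0)
      by (apply Rle_trans with (2 := Req_le _ _ H);
          exact (c0_coord_dist (exist _ x Hx) (exist _ y Hy) n)).
    assert (B := abs_ge_0 (minus (x n) (y n))).
    assert (C := abs_eq_zero (minus (x n) (y n)) ltac:(apply Rle_antisym; assumption)).
    apply (plus_reg_r (opp (y n))).
    apply eq_trans with (1 := C); symmetry; exact (plus_opp_r (G := AbsRing.AbelianGroup K) (y n)). }
  subst y; f_equal; apply proof_irrelevance.
- intros ->; apply Rle_antisym; [|apply Rge_le, c0_dist_pos].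
  apply sup_norm_le; intros n; rewrite minus_eq_zero.
  apply Req_le, abs_zero.
Qed.

Lemma c0_dist_tri (x y z : c0 K) : c0_dist x y <= c0_dist x z + c0_dist z y.
Proof.
apply sup_norm_le; intros n.
assert (H1 := c0_coord_dist x z n); assert (H2 := c0_coord_dist z y n).
rewrite (minus_trans (c0_coord z n)).
apply Rle_trans with (1 := abs_triangle _ _).
apply Rplus_le_compat; assumption.
Qed.

End C0Metric.

Definition c0_metric (K : AbsRing) : Metric_Space :=
  Build_Metric_Space (c0 K) c0_dist c0_dist_pos c0_dist_sym c0_dist_refl
    c0_dist_tri.

Section Shift.

Context {K : AbsRing} (w : Z -> K) (hw : bounded_family w).

Lemma shift_vanishes (x : c0 K) :
  vanishes_at_infinity (fun n => mult (w n) (c0_coord x (n + 1)%Z)).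
Proof.
destruct hw as [M HM]; destruct x as [x Hx]; simpl; intros eps He.
assert (M0 : 0 <= M) by (eapply Rle_trans; [apply (abs_ge_0 (w 0%Z)) | apply (HM 0%Z)]).
destruct (Hx (eps / (M + 1))) as [N HN]; [apply Rdiv_lt_0_compat; lra|].
exists (N + 1)%Z; intros n Hn.
assert (A := HN (n + 1)%Z ltac:(lia)).
apply Rle_lt_trans with (1 := abs_mult _ _).
apply Rle_lt_trans with (M * abs (x (n + 1)%Z)).
- apply Rmult_le_compat_r; [apply abs_ge_0 | apply HM].
- apply Rle_lt_trans with ((M + 1) * abs (x (n + 1)%Z)).
  + apply Rmult_le_compat_r; [apply abs_ge_0 | lra].
  + replace eps with ((M + 1) * (eps / (M + 1))) by (field; lra).
    apply Rmult_lt_compat_l; lra.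
Qed.

Definition shift_fun (x : c0 K) : c0 K :=
  exist _ (fun n => mult (w n) (c0_coord x (n + 1)%Z)) (shift_vanishes x).

Lemma shift_continuous (x : Base (c0_metric K)) :
  limit_in (c0_metric K) (c0_metric K) shift_fun (fun _ => True) x
    (shift_fun x).
Proof.
destruct hw as [M HM]; simpl in *; intros eps He.
assert (M0 : 0 <= M) by (eapply Rle_trans; [apply (abs_ge_0 (w 0%Z)) | apply (HM 0%Z)]).
exists (eps / (M + 1)); split; [apply Rdiv_lt_0_compat; lra|].
intros y [_ Hy]; simpl in *.
apply Rle_lt_trans with ((M + 1) * c0_dist y x).
- apply sup_norm_le; intros n; simpl.
  assert (E : forall a b c : K,
    minus (mult a b) (mult a c) = mult a (minus b c)).
  { intros a b c; symmetry.
    apply eq_trans with (1 := mult_distr_l (K := AbsRing.Ring K) a b (opp c)).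
    unfold minus; apply f_equal; symmetry.
    exact (opp_mult_r (K := AbsRing.Ring K) a c). }
  rewrite E; apply Rle_trans with (1 := abs_mult _ _).
  apply Rmult_le_compat; try apply abs_ge_0.
  + assert (A := HM n); lra.
  + apply c0_coord_dist.
- replace eps with ((M + 1) * (eps / (M + 1))) by (field; lra).
  apply Rmult_lt_compat_l; lra.
Qed.

Definition weighted_backward_shift : continuous_self_map (c0_metric K) :=
  {| self_map := shift_fun : Base (c0_metric K) -> Base (c0_metric K);
     self_map_continuous := shift_continuous |}.

(* [w i * ... * w j]; the empty product [one] when [j < i]. *)
Definition weight_prod (i j : Z) : K :=
  fold_right mult one
    (map (fun k => w (i + Z.of_nat k)%Z) (seq 0 (Z.to_nat (j - i + 1)))).

End Shift.

(* Main.v *)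
(* Since [(T^n x)_i = w_i ... w_(i+n-1) x_(i+n)], everything is governed by the
   sizes of the runs [w_i ... w_(i+n-1)]. If all runs are bounded, [T] is power
   bounded, so [liminf |T^n x - T^n y| = 0] forces the limit to be [0]; and a
   nonzero coordinate of [x - y] forces (a).

   Conversely, (a) and (b) give, after any finite stage [N], a time [s] at which
   all vectors supported in [[-N, N]] are nearly annihilated and a later
   coordinate [m] at which a bump of height [1 / ((N+1) M^s)], too small to be
   seen at time [s], is later amplified to size at least [1]. Placing such bumps
   at [m_0, m_1, ...], switched on or off by binary sequences that differ
   infinitely often whenever they differ, gives an uncountable scrambled set. *)
Require Import Defs.
From Stdlib Require Import Reals ZArith.
From Coquelicot Require Import Coquelicot.
From Stdlib Require Import Lra Lia List Classical IndefiniteDescription Cantor.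
Open Scope R_scope.

(** * Products of consecutive positive weights *)

Section Run.

Context (a : Z -> R).

(** Indexed by start and length instead of both ends: lengths add under concatenation, and the empty
    run is 1. The first index after the run is [i + n]. *)
Fixpoint run (i : Z) (n : nat) : R :=
  match n with
  | O => 1
  | S n' => a i * run (i + 1) n'
  end.

Lemma run_add (i : Z) (m n : nat) :
  run i (m + n) = run i m * run (i + Z.of_nat m) n.
Proof.
revert i; induction m as [|m IH]; intros i; simpl.
- rewrite Z.add_0_r; ring.
- rewrite IH, Rmult_assoc; do 3 f_equal; lia.
Qed.

(** Total length and splitting point are free variables, so that [lia] can settle them in any
    syntactic form. *)
Lemma run_split (i : Z) (m n k : nat) (j : Z) :
  k = (m + n)%nat -> j = (i + Z.of_nat m)%Z -> run i k = run i m * run j n.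
Proof. intros -> ->; apply run_add. Qed.

Context (a_pos : forall i, 0 < a i).

Lemma run_pos (i : Z) (n : nat) : 0 < run i n.
Proof.
revert i; induction n as [|n IH]; intros i; simpl; [lra|].
apply Rmult_lt_0_compat; auto.
Qed.

Context (M : R) (M_ge : 2 <= M) (a_le : forall i, a i <= M).

Lemma run_le_pow (i : Z) (n : nat) : run i n <= M ^ n.
Proof.
revert i; induction n as [|n IH]; intros i; simpl; [lra|].
apply Rmult_le_compat; auto; apply Rlt_le; auto using run_pos.
Qed.

Lemma bound_pow_pos (n : nat) : 0 < M ^ n.
Proof. apply pow_lt; lra. Qed.

Lemma run_le_pow_le (i : Z) (m n : nat) : (m <= n)%nat -> run i m <= M ^ n.
Proof.
intros H; apply Rle_trans with (1 := run_le_pow i m), Rle_pow; [lra | exact H].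
Qed.

Lemma run_small (eps : R) (N : nat) :
  (forall eps', 0 < eps' -> forall n0, exists n, (n0 <= n)%nat /\
     run (- Z.of_nat n) n < eps') ->
  0 < eps ->
  exists s, (N <= s)%nat /\
    forall j, (Z.abs j <= Z.of_nat N)%Z -> run (j - Z.of_nat s) s <= eps.
Proof.
intros Hinf He.
set (c := run (- Z.of_nat N) N).
assert (Hc : 0 < c) by apply run_pos.
set (B := M ^ (2 * N)).
assert (HB : 0 < B) by apply bound_pow_pos.
(* The core from [-n] to [-N - 1] is [run (- n) n] divided by [c]; each factor [B] bounds one of the
   two end pieces, of at most [2 * N] weights. *)
destruct (Hinf (eps * c / (B * B))) with (n0 := N) as [n [Hn Hs]].
{ apply Rdiv_lt_0_compat; apply Rmult_lt_0_compat; assumption. }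
(* Adding [N] makes the run just before any [j] with [|j| <= N] start at or left of [-n], so one [s]
   serves all [j]. *)
exists (n + N)%nat; split; [lia|]; intros j Hj.
assert (E1 : run (- Z.of_nat n) n = run (- Z.of_nat n) (n - N) * c)
  by (apply run_split; lia).
set (i := Z.to_nat (Z.of_nat N - j)); set (k := Z.to_nat (j + Z.of_nat N)).
assert (E2 : run (j - Z.of_nat (n + N)) (n + N) =
  run (j - Z.of_nat (n + N)) i *
  (run (- Z.of_nat n) (n - N) * run (- Z.of_nat N) k)).
{ rewrite (run_split _ i (n - N + k) _ (- Z.of_nat n)) by lia.
  f_equal; apply run_split; lia. }
set (q := run (- Z.of_nat n) (n - N)) in *.
assert (Hq : 0 < q) by apply run_pos.
assert (Hqc : q < eps / (B * B)).
{ apply Rmult_lt_reg_r with c; [assumption|].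
  rewrite <- E1; replace (eps / (B * B) * c) with (eps * c / (B * B)); [assumption|].
  field; lra. }
assert (H1 : run (j - Z.of_nat (n + N)) i <= B) by (apply run_le_pow_le; lia).
assert (H2 : run (- Z.of_nat N) k <= B) by (apply run_le_pow_le; lia).
rewrite E2; apply Rle_trans with (B * (eps / (B * B) * B)).
- apply Rmult_le_compat; auto using Rlt_le, run_pos, Rmult_lt_0_compat.
  apply Rmult_le_compat; auto using Rlt_le, run_pos.
- apply Req_le; field; lra.
Qed.

(* If all runs ending outside [[-N, N]] were bounded, comparison with the runs
   ending at [N] would bound the others too. *)
Lemma run_large (N : nat) (C : R) :
  (forall C', exists i n, C' < run i n) ->
  exists m r, (Z.of_nat N < Z.abs m)%Z /\ C <= run (m - Z.of_nat r) r.
Proof.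
intros Hsup; apply NNPP; intros Hno.
assert (H : forall m r, (Z.of_nat N < Z.abs m)%Z -> run (m - Z.of_nat r) r < C).
{ intros m r Hm; apply Rnot_le_lt; intros Hr; apply Hno; exists m, r; auto. }
set (B := M ^ (2 * N)).
assert (HB : 0 < B) by apply bound_pow_pos.
set (c := run (- Z.of_nat N) (2 * N + 1)).
assert (Hc : 0 < c) by apply run_pos.
destruct (Hsup (Rmax C (C * B / c))) as [i [r Hr]].
set (m := (i + Z.of_nat r)%Z).
destruct (Z_lt_le_dec (Z.of_nat N) (Z.abs m)) as [Hm|Hm].
- assert (A := H m r Hm); replace (m - Z.of_nat r)%Z with i in A by lia.
  assert (A' := Rmax_l C (C * B / c)); lra.
(* [m] is the index just after the run, so extending the run through the weight at [N] moves this
   index to [N + 1], outside the window. The added factor is at least [c / B], since [c] is that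
   factor times at most [2 * N] further weights. *)
- set (k := Z.to_nat (Z.of_nat N + 1 - m)).
  assert (A := H (Z.of_nat N + 1)%Z (r + k)%nat ltac:(lia)).
  rewrite (run_split _ r k _ m) in A by lia.
  replace (Z.of_nat N + 1 - Z.of_nat (r + k))%Z with i in A by lia.
  set (l := Z.to_nat (m + Z.of_nat N)).
  assert (E : c = run (- Z.of_nat N) l * run m k) by (apply run_split; lia).
  assert (Hl : run (- Z.of_nat N) l <= B) by (apply run_le_pow_le; lia).
  assert (Hk : 0 < run m k) by apply run_pos.
  assert (Hir : 0 < run i r) by apply run_pos.
  assert (Hcb : c <= B * run m k)
    by (rewrite E; apply Rmult_le_compat_r; lra).
  assert (run i r * c <= C * B).
  { apply Rle_trans with (run i r * (B * run m k)).
    - apply Rmult_le_compat_l; lra.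
    - replace (run i r * (B * run m k)) with (run i r * run m k * B) by ring.
      apply Rmult_le_compat_r; lra. }
  assert (C * B / c < run i r)
    by (apply Rle_lt_trans with (2 := Hr), Rmax_r).
  assert (C * B < run i r * c) by (apply Rlt_div_l; assumption).
  lra.
Qed.

Lemma run_small_large (N : nat) :
  (forall eps, 0 < eps -> forall n0, exists n, (n0 <= n)%nat /\
     run (- Z.of_nat n) n < eps) ->
  (forall C, exists i n, C < run i n) ->
  exists (s : nat) (m : Z) (r : nat),
    ((N <= s)%nat /\ (N <= r)%nat /\ (Z.of_nat N < Z.abs m)%Z) /\
    (forall j, (Z.abs j <= Z.of_nat N)%Z ->
       run (j - Z.of_nat s) s <= / (INR N + 1)) /\
    (INR N + 1) * M ^ s <= run (m - Z.of_nat r) r.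
Proof.
intros Hinf Hsup.
assert (HN := pos_INR N).
destruct (run_small (/ (INR N + 1)) N Hinf) as [s [Hs1 Hs2]].
{ apply Rinv_0_lt_compat; lra. }
destruct (run_large N ((INR N + 1) * M ^ s) Hsup) as [m [r [Hm Hr]]].
exists s, m, r; repeat split; auto.
(* What remains is [N <= r]: a run shorter than [s] is at most [M ^ r < M ^ s] and cannot reach the
   required size. *)
apply Nat.le_trans with (1 := Hs1), Nat.nlt_ge; intros Hrs.
assert (A := run_le_pow (m - Z.of_nat r) r).
assert (B : M ^ r < M ^ s) by (apply Rlt_pow; [lra | exact Hrs]).
assert (D : 1 * M ^ s <= (INR N + 1) * M ^ s)
  by (apply Rmult_le_compat_r; [apply Rlt_le, bound_pow_pos | lra]).
lra.
Qed.

End Run.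

(** * Lower and upper limits of real sequences, and countability *)

Lemma LimInf_seq_eq_0 (u : nat -> R) :
  (forall n, 0 <= u n) ->
  LimInf_seq u = 0 <->
  (forall eps, 0 < eps -> forall N, exists n, (N <= n)%nat /\ u n < eps).
Proof.
intros Hu; split.
- intros H eps He N; unfold LimInf_seq in H.
  destruct (ex_LimInf_seq u) as [l Hl]; simpl in H; subst l.
  destruct (Hl (mkposreal eps He)) as [A _].
  destruct (A N) as [n Hn]; simpl in Hn; exists n; rewrite Rplus_0_l in Hn; exact Hn.
- intros H; apply is_LimInf_seq_unique; intros [eps He]; simpl; split.
  + intros N; rewrite Rplus_0_l; apply H, He.
  (* Nonnegativity makes the eventual lower bound automatic. *)
  + exists 0%nat; intros n _; assert (A := Hu n); lra.
Qed.

Lemma LimSup_seq_pos (u : nat -> R) (c : R) :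
  0 < c -> (forall N, exists n, (N <= n)%nat /\ c <= u n) ->
  Rbar_lt 0 (LimSup_seq u).
Proof.
intros Hc H; unfold LimSup_seq; destruct (ex_LimSup_seq u) as [l Hl]; simpl.
destruct l as [l| |]; simpl in *; auto.
- destruct (Rlt_or_le 0 l) as [Hl0|Hl0]; [exact Hl0|].
  destruct (Hl (mkposreal c Hc)) as [_ [N HN]].
  destruct (H N) as [n [Hn Hcn]]; assert (A := HN n Hn); simpl in A; lra.
- destruct (Hl c) as [N HN]; destruct (H N) as [n [Hn Hcn]].
  assert (A := HN n Hn); lra.
Qed.

Lemma LimSup_seq_eventually_le (u : nat -> R) :
  (forall eps, 0 < eps -> exists N, forall n, (N <= n)%nat -> u n <= eps) ->
  ~ Rbar_lt 0 (LimSup_seq u).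
Proof.
intros H Hpos.
assert (Hle : forall eps, 0 < eps -> Rbar_le (LimSup_seq u) eps).
{ intros eps He; rewrite <- (LimSup_seq_const eps).
  apply LimSup_le; exact (H eps He). }
destruct (LimSup_seq u) as [l| |]; simpl in *.
- assert (A := Hle (l / 2) ltac:(lra)); lra.
- exact (Hle 1 Rlt_0_1).
- exact Hpos.
Qed.

(** Cantor's diagonal argument: [d] is true at [n] exactly when some sequence with code [n] is false
    at [n]; the value at the code of [d] is contradictory. *)
Lemma bool_seq_uncountable (f : (nat -> bool) -> nat) :
  ~ (forall x y, f x = f y -> x = y).
Proof.
intros Hf.
destruct (functional_choice (fun n b => b = true <->
  exists x, f x = n /\ x n = false)) as [d Hd].
{ intros n; destruct (classic (exists x, f x = n /\ x n = false)) as [H|H].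
  - exists true; tauto.
  - exists false; split; [discriminate | tauto]. }
destruct (Hd (f d)) as [H1 H2].
destruct (d (f d)) eqn:E.
- destruct (H1 eq_refl) as [x [Hx Hx']].
  apply Hf in Hx; subst x; congruence.
- discriminate H2; exists d; auto.
Qed.

(** Necessity of both conditions uses a single scrambled pair. *)
Lemma not_countable_two_points {T : Type} (S : T -> Prop) :
  ~ countable S -> exists x y, S x /\ S y /\ x <> y.
Proof.
intros H; apply NNPP; intros Hno; apply H.
exists (fun _ => 0%nat); intros x y Hx Hy _.
apply NNPP; intros Hxy; apply Hno; exists x, y; auto.
Qed.

(** * Absolute values of scalars *)

Lemma abs_minus_diag {K : AbsRing} (x : K) : abs (minus x x) = 0.
Proof. rewrite minus_eq_zero; apply abs_zero. Qed.

(** An absolute value ring is in general only submultiplicative; lower bounds on orbits need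
    equality. *)
Definition abs_multiplicative (K : AbsRing) : Prop :=
  forall x y : K, abs (mult x y) = abs x * abs y.

Lemma scalar_abs_multiplicative (K : AbsRing) :
  K = R_AbsRing \/ K = C_AbsRing -> abs_multiplicative K.
Proof.
intros [-> | ->] x y; [apply Rabs_mult | apply Cmod_mult].
Qed.

(** Supplies scalars for bumps of prescribed height. *)
Lemma scalar_abs_surj (K : AbsRing) :
  K = R_AbsRing \/ K = C_AbsRing ->
  forall r, 0 <= r -> exists c : K, abs c = r.
Proof.
intros [-> | ->] r Hr.
- exists r; apply Rabs_pos_eq, Hr.
- exists (RtoC r); apply eq_trans with (1 := Cmod_R r), Rabs_pos_eq, Hr.
Qed.

(** * Iterates of the shift expressed through runs *)

Section Shift.

Context {K : AbsRing} (abs_mul : abs_multiplicative K).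
Context (w : Z -> K) (hw : bounded_family w).

Notation a := (fun n => abs (w n)).
Notation T := (shift_fun w hw).

Lemma abs_weight_prod (i j : Z) (n : nat) :
  j = (i + Z.of_nat n - 1)%Z -> abs (weight_prod w i j) = run a i n.
Proof.
intros ->; unfold weight_prod.
replace (Z.to_nat (i + Z.of_nat n - 1 - i + 1)) with n by lia.
revert i; induction n as [|n IH]; intros i; simpl; [apply abs_one|].
rewrite abs_mul, Z.add_0_r; f_equal.
rewrite <- IH, <- seq_shift, map_map; do 2 f_equal.
apply map_ext; intros k; f_equal; lia.
Qed.

Lemma abs_iter_shift_minus (n : nat) (x y : c0 K) (i : Z) :
  abs (minus (c0_coord (Nat.iter n T x) i) (c0_coord (Nat.iter n T y) i)) =
  run a i n *
  abs (minus (c0_coord x (i + Z.of_nat n)) (c0_coord y (i + Z.of_nat n))).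
Proof.
revert i; induction n as [|n IH]; intros i; simpl.
- rewrite Z.add_0_r; ring.
- assert (E : forall a b c : K,
    minus (mult a b) (mult a c) = mult a (minus b c)).
  { intros a b c; symmetry.
    apply eq_trans with (1 := mult_distr_l (K := AbsRing.Ring K) a b (opp c)).
    unfold minus; apply f_equal; symmetry.
    exact (opp_mult_r (K := AbsRing.Ring K) a c). }
  rewrite E, abs_mul, IH, Rmult_assoc; do 3 f_equal; f_equal; f_equal; lia.
Qed.

Lemma iter_shift_dist_ge (n : nat) (x y : c0 K) (i : Z) :
  run a i n *
  abs (minus (c0_coord x (i + Z.of_nat n)) (c0_coord y (i + Z.of_nat n)))
  <= c0_dist (Nat.iter n T x) (Nat.iter n T y).
Proof. rewrite <- abs_iter_shift_minus; apply c0_coord_dist. Qed.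

(** Indexed by the source coordinate [j] instead of its image [j - n], because bumps are known by
    where they start. *)
Lemma iter_shift_dist_le (n : nat) (x y : c0 K) (C : R) :
  (forall j, run a (j - Z.of_nat n) n * abs (minus (c0_coord x j) (c0_coord y j))
     <= C) ->
  c0_dist (Nat.iter n T x) (Nat.iter n T y) <= C.
Proof.
intros H; apply sup_norm_le; intros i; rewrite abs_iter_shift_minus.
assert (A := H (i + Z.of_nat n)%Z).
replace (i + Z.of_nat n - Z.of_nat n)%Z with i in A by lia; exact A.
Qed.

Context (hw0 : forall n, w n <> zero).

Lemma abs_weight_pos (i : Z) : 0 < a i.
Proof. apply abs_gt_0, hw0. Qed.

(* If [|x_m - y_m| > 0] then [T^n] sends it to coordinate [m - n], multiplied by
   the run [w_(m-n), ..., w_(m-1)], which differs from [w_(-n'), ..., w_(-1)],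
   [n' = n - m], by a fixed nonzero factor. *)
Lemma proximal_runs_small (x y : c0 K) :
  x <> y ->
  (forall eps, 0 < eps -> forall N, exists n, (N <= n)%nat /\
     c0_dist (Nat.iter n T x) (Nat.iter n T y) < eps) ->
  forall eps, 0 < eps -> forall N, exists n, (N <= n)%nat /\
    run a (- Z.of_nat n) n < eps.
Proof.
intros Hxy Hprox eps He N.
assert (Hm : exists m, c0_coord x m <> c0_coord y m).
{ apply NNPP; intros Hno; apply Hxy, c0_dist_refl, Rle_antisym;
    [|apply Rge_le, c0_dist_pos].
  apply sup_norm_le; intros n.
  replace (c0_coord y n) with (c0_coord x n)
    by (apply NNPP; intros Hn; apply Hno; exists n; exact Hn).
  apply Req_le, abs_minus_diag. }
destruct Hm as [m Hm].
set (d := abs (minus (c0_coord x m) (c0_coord y m))).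
assert (Hd : 0 < d) by (apply abs_minus_gt_0, Hm).
(* Truncation makes one of [k], [l] zero and [m = k - l], which treats both signs of [m] at once:
   the two runs to compare are prolonged to the common end [max m 0]. *)
set (k := Z.to_nat m); set (l := Z.to_nat (- m)).
set (ck := run a 0 k); set (cl := run a m l).
assert (Hck : 0 < ck) by (apply run_pos, abs_weight_pos).
assert (Hcl : 0 < cl) by (apply run_pos, abs_weight_pos).
(* The threshold undoes the factors [d] and [cl / ck]; the shift of [N] by [k] keeps [n + l - k]
   above [N]. *)
destruct (Hprox (eps * d * ck / cl)) with (N := (N + k)%nat) as [n [Hn Hs]].
{ apply Rdiv_lt_0_compat; repeat apply Rmult_lt_0_compat; assumption. }
exists (n + l - k)%nat; split; [lia|].
set (q := run a (- Z.of_nat (n + l - k)) (n + l - k)).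
assert (E1 : q * ck = run a (- Z.of_nat (n + l - k)) (n + l))
  by (symmetry; apply run_split; lia).
assert (E2 : run a (- Z.of_nat (n + l - k)) (n + l) =
  run a (m - Z.of_nat n) n * cl).
{ replace (- Z.of_nat (n + l - k))%Z with (m - Z.of_nat n)%Z by lia.
  apply run_split; lia. }
assert (A := iter_shift_dist_ge n x y (m - Z.of_nat n)).
replace (m - Z.of_nat n + Z.of_nat n)%Z with m in A by lia; fold d in A.
rewrite <- E1 in E2.
apply Rmult_lt_reg_r with ck; [assumption|]; rewrite E2.
apply Rmult_lt_reg_r with d; [assumption|].
replace (run a (m - Z.of_nat n) n * cl * d)
  with (run a (m - Z.of_nat n) n * d * cl) by ring.
replace (eps * ck * d) with (eps * d * ck / cl * cl) by (field; lra).
apply Rmult_lt_compat_r; lra.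
Qed.

(** All iterates are [C]-Lipschitz, so one distance below [eps / C] controls every later one. *)
Lemma bounded_runs_asymptotic (x y : c0 K) (C : R) :
  (forall i n, run a i n <= C) ->
  (forall eps, 0 < eps -> forall N, exists n, (N <= n)%nat /\
     c0_dist (Nat.iter n T x) (Nat.iter n T y) < eps) ->
  forall eps, 0 < eps -> exists N, forall n, (N <= n)%nat ->
    c0_dist (Nat.iter n T x) (Nat.iter n T y) <= eps.
Proof.
intros HC Hprox eps He.
assert (C1 : 1 <= C) by apply (HC 0%Z 0%nat).
destruct (Hprox (eps / C)) with (N := 0%nat) as [N [_ HN]].
{ apply Rdiv_lt_0_compat; lra. }
exists N; intros n Hn.
replace n with ((n - N) + N)%nat by lia; rewrite !Nat.iter_add.
apply iter_shift_dist_le; intros j.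
replace eps with (C * (eps / C)) by (field; lra).
apply Rmult_le_compat.
- apply Rlt_le, run_pos, abs_weight_pos.
- apply abs_ge_0.
- apply HC.
- apply Rle_trans with (1 := c0_coord_dist _ _ j); lra.
Qed.

Lemma weight_prod_sup_infinite :
  Lub_Rbar (fun r => exists i j : Z,
    (i <= j)%Z /\ r = abs (weight_prod w i j)) = p_infty <->
  (forall C, exists i n, C < run a i n).
Proof.
set (E := fun r => _).
destruct (Lub_Rbar_correct E) as [Hub Hlub]; split.
- intros H C; rewrite H in Hlub; apply NNPP; intros Hno.
  apply (Hlub C); intros r [i [j [Hij ->]]]; simpl.
  rewrite (abs_weight_prod i j (Z.to_nat (j - i + 1))) by lia.
  apply Rnot_lt_le; intros Hlt; apply Hno; exists i, (Z.to_nat (j - i + 1)); exact Hlt.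
- intros H.
  assert (Hn : forall i n, (1 <= n)%nat -> Rbar_le (run a i n) (Lub_Rbar E)).
  { intros i n Hn; apply Hub; exists i, (i + Z.of_nat n - 1)%Z; split; [lia|].
    symmetry; apply abs_weight_prod; reflexivity. }
  destruct (Lub_Rbar E) as [l| |]; [|reflexivity|].
  (* The supremum ranges over nonempty products only; exceeding 1 rules out the empty run. *)
  + destruct (H (Rmax l 1)) as [i [n Hin]].
    assert (A1 := Rmax_l l 1); assert (A2 := Rmax_r l 1).
    destruct n as [|n]; [simpl in Hin; lra|].
    assert (A : run a i (S n) <= l) by (apply Hn; lia); lra.
  + destruct (Hn 0%Z 1%nat ltac:(lia)).
Qed.

Lemma weight_prod_liminf_0 :
  LimInf_seq (fun n : nat => abs (weight_prod w (- Z.of_nat n) (-1))) = 0 <->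
  (forall eps, 0 < eps -> forall N, exists n, (N <= n)%nat /\
     run a (- Z.of_nat n) n < eps).
Proof.
rewrite LimInf_seq_eq_0 by (intros; apply abs_ge_0).
assert (E : forall n, abs (weight_prod w (- Z.of_nat n) (-1)) =
  run a (- Z.of_nat n) n) by (intros n; apply abs_weight_prod; lia).
split; intros H eps He N; destruct (H eps He N) as [n Hn]; exists n;
  rewrite E in *; exact Hn.
Qed.

(** * The scrambled set built from sparse bumps *)

Section Scrambled.

Context (M : R) (M_ge : 2 <= M) (a_le : forall i, a i <= M).
Context (abs_surj : forall r, 0 <= r -> exists c : K, abs c = r).
(** At stage [k], [N k] is the radius of the window, [s k] the time of near annihilation, [m k] the
    place of the bump and [r k] the time at which it has grown. Later windows contain earlier
    bumps. *)
Context (N s r : nat -> nat) (m : nat -> Z).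
Context (N_ge : forall k, (k <= N k)%nat) (s_ge : forall k, (N k <= s k)%nat).
Context (r_ge : forall k, (N k <= r k)%nat).
Context (m_gt : forall k, (Z.of_nat (N k) < Z.abs (m k))%Z).
Context (next_m : forall k l, (k < l)%nat -> (Z.abs (m k) <= Z.of_nat (N l))%Z).
Context (next_s : forall k l, (k < l)%nat -> (s k <= N l)%nat).
Context (small : forall k j, (Z.abs j <= Z.of_nat (N k))%Z ->
  run a (j - Z.of_nat (s k)) (s k) <= / (INR (N k) + 1)).
Context (large : forall k,
  (INR (N k) + 1) * M ^ s k <= run a (m k - Z.of_nat (r k)) (r k)).

(* The height of the [k]-th bump: the largest one that is still small after
   [s k] steps. *)
Definition height (k : nat) : R := / ((INR (N k) + 1) * M ^ s k).

Lemma height_denom_pos (k : nat) : 0 < (INR (N k) + 1) * M ^ s k.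
Proof.
apply Rmult_lt_0_compat; [assert (A := pos_INR (N k)); lra|].
apply bound_pow_pos; exact M_ge.
Qed.

Lemma height_pos (k : nat) : 0 < height k.
Proof. apply Rinv_0_lt_compat, height_denom_pos. Qed.

(** Lets the estimate for bump [k] at time [s k] cover all later bumps. *)
Lemma height_anti (k l : nat) : (k <= l)%nat -> height l <= height k.
Proof.
intros Hkl; apply Rinv_le_contravar; [apply height_denom_pos|].
assert (A := pos_INR (N k)).
destruct (Nat.eq_dec k l) as [->|Hne]; [lra|].
assert (Hs : (s k <= N l)%nat) by (apply next_s; lia).
assert (HN : (N k <= s k)%nat) by apply s_ge.
assert (HN' : (N l <= s l)%nat) by apply s_ge.
apply Rmult_le_compat; try lra.
- apply Rlt_le, bound_pow_pos, M_ge.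
- apply Rplus_le_compat_r, le_INR; lia.
- apply Rle_pow; [lra | lia].
Qed.

Lemma height_le_inv (k : nat) : height k <= / (INR k + 1).
Proof.
assert (A := pos_INR k).
apply Rinv_le_contravar; [lra|].
assert (B : INR k <= INR (N k)) by apply le_INR, N_ge.
rewrite <- (Rmult_1_r (INR k + 1)); apply Rmult_le_compat; try lra.
apply pow_R1_Rle; lra.
Qed.

Lemma m_inj (k l : nat) : m k = m l -> k = l.
Proof.
intros E; destruct (Nat.lt_trichotomy k l) as [H|[H|H]]; [|exact H|].
- assert (A := next_m k l H); assert (B := m_gt l); rewrite E in A; lia.
- assert (A := next_m l k H); assert (B := m_gt k); rewrite E in B; lia.
Qed.

(** Bump [k] is switched by the bit whose index is the first component of the pair coded by [k].
    Each bit thus governs infinitely many bumps, and sequences differing in one bit give vectors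
    differing at arbitrarily late bumps. *)
Lemma exists_bumps : exists z : (nat -> bool) -> c0 K,
  forall x y,
    (forall k, x (fst (Cantor.of_nat k)) <> y (fst (Cantor.of_nat k)) ->
       abs (minus (c0_coord (z x) (m k)) (c0_coord (z y) (m k))) = height k) /\
    (forall j, abs (minus (c0_coord (z x) j) (c0_coord (z y) j)) = 0 \/
       exists k, j = m k /\
         abs (minus (c0_coord (z x) j) (c0_coord (z y) j)) = height k).
Proof.
destruct (functional_choice (fun j o => forall k, o = Some k <-> j = m k))
  as [idx Hidx].
{ intros j; destruct (classic (exists k, j = m k)) as [[k Hk]|Hno].
  - exists (Some k); intros l; split.
    + intros E; injection E as <-; exact Hk.
    + intros E; f_equal; apply m_inj; congruence.
  - exists None; intros k; split; [discriminate|].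
    intros E; destruct Hno; exists k; exact E. }
destruct (functional_choice (fun k (c : K) => abs c = height k)) as [c Hc].
{ intros k; apply abs_surj, Rlt_le, height_pos. }
set (v := fun (x : nat -> bool) j =>
  match idx j with
  | Some k => if x (fst (Cantor.of_nat k)) then c k else zero
  | None => zero
  end).
assert (Hv : forall x, vanishes_at_infinity (v x)).
{ intros x eps He.
  destruct (archimed_cor1 eps He) as [k [Hk1 Hk2]].
  exists (Z.of_nat (N k) + 1)%Z; intros j Hj; unfold v.
  destruct (idx j) as [l|] eqn:E; [|rewrite abs_zero; exact He].
  destruct (x _); [|rewrite abs_zero; exact He].
  apply Hidx in E; subst j; rewrite Hc.
  (* Bumps of index below [k] lie within radius [N k], and this one lies farther out. *)
  assert (Hkl : (k <= l)%nat).
  { apply Nat.nlt_ge; intros H; assert (A := next_m l k H); lia. }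
  assert (B := height_anti k l Hkl); assert (D := height_le_inv k).
  assert (F : / (INR k + 1) <= / INR k)
    by (apply Rinv_le_contravar; [apply lt_0_INR, Hk2 | lra]).
  lra. }
exists (fun x => exist _ (v x) (Hv x)); intros x y; simpl.
assert (Hd : forall k, x (fst (Cantor.of_nat k)) <> y (fst (Cantor.of_nat k)) ->
  abs (minus (v x (m k)) (v y (m k))) = height k).
{ intros k Hk; unfold v; rewrite (proj2 (Hidx (m k) k) eq_refl).
  destruct (x _), (y _); try congruence; [|rewrite abs_minus];
    rewrite <- Hc; f_equal; exact (minus_zero_r (c k)). }
split; [exact Hd|]; intros j.
assert (Heq : v x j = v y j -> abs (minus (v x j) (v y j)) = 0).
{ intros ->; apply abs_minus_diag. }
destruct (idx j) as [k|] eqn:E.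
- destruct (Bool.bool_dec (x (fst (Cantor.of_nat k))) (y (fst (Cantor.of_nat k))))
    as [H|H].
  + left; apply Heq; unfold v; rewrite E, H; reflexivity.
  + right; exists k; apply Hidx in E; subst j; auto.
- left; apply Heq; unfold v; rewrite E; reflexivity.
Qed.

Lemma bumps_chaotic :
  li_yorke_chaotic (c0_metric K) (weighted_backward_shift w hw).
Proof.
destruct exists_bumps as [z Hz].
assert (Hne : forall x y : nat -> bool, x <> y -> exists i, x i <> y i).
{ intros x y Hxy; apply NNPP; intros Hno; apply Hxy.
  apply FunctionalExtensionality.functional_extensionality; intros i.
  apply NNPP; intros Hi; apply Hno; exists i; exact Hi. }
assert (Hbig : forall x y, x <> y -> forall n0, exists k, (n0 <= k)%nat /\
  abs (minus (c0_coord (z x) (m k)) (c0_coord (z y) (m k))) = height k).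
{ intros x y Hxy n0; destruct (Hne x y Hxy) as [i Hi].
  (* The code of [(i, n0)] is at least [n0], and its bump carries bit [i]. *)
  exists (Cantor.to_nat (i, n0)); split.
  - assert (A := Cantor.to_nat_non_decreasing i n0); lia.
  - apply Hz; rewrite Cantor.cancel_of_to; exact Hi. }
exists (fun p => exists x, p = z x); split.
- intros [f Hf]; apply (bool_seq_uncountable (fun x => f (z x))).
  intros x y E; apply Hf in E; [|exists x; reflexivity|exists y; reflexivity].
  apply NNPP; intros Hxy; destruct (Hbig x y Hxy 0%nat) as [k [_ Hk]].
  rewrite E, abs_minus_diag in Hk; assert (A := height_pos k); lra.
- intros p q [x ->] [y ->] Hpq.
  assert (Hxy : x <> y) by congruence.
  split.
  + apply LimInf_seq_eq_0; [intros n; apply Rge_le, c0_dist_pos|].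
    intros eps He n0.
    destruct (archimed_cor1 eps He) as [k0 [Hk1 Hk2]].
    set (k := (n0 + k0)%nat).
    assert (HNk := N_ge k); assert (Hsk := s_ge k).
    exists (s k); split; [lia|].
    assert (HNk' : INR k0 <= INR (N k)) by (apply le_INR; lia).
    assert (Hk0 := lt_0_INR k0 Hk2).
    assert (Hinv : / (INR (N k) + 1) < / INR k0)
      by (apply Rinv_lt_contravar; [apply Rmult_lt_0_compat; lra | lra]).
    assert (Hinv0 : 0 < / (INR (N k) + 1)) by (apply Rinv_0_lt_compat; lra).
    apply Rle_lt_trans with (/ (INR (N k) + 1)); [|lra].
    apply iter_shift_dist_le; intros j.
    assert (Hrun := run_pos a abs_weight_pos (j - Z.of_nat (s k)) (s k)).
    destruct (proj2 (Hz x y) j) as [->|[l [-> ->]]]; [lra|].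
    assert (Hh := height_pos l).
    (* Bumps inside the window have height at most 1 and are damped by [small]; those outside have
       index at least [k], and their height absorbs the largest possible growth [M ^ s k]. *)
    destruct (Z_le_gt_dec (Z.abs (m l)) (Z.of_nat (N k))) as [Hj|Hj].
    * rewrite <- (Rmult_1_r (/ (INR (N k) + 1))).
      apply Rmult_le_compat; try lra; [apply small, Hj|].
      apply Rle_trans with (1 := height_le_inv l).
      rewrite <- Rinv_1; apply Rinv_le_contravar; [lra|].
      assert (A := pos_INR l); lra.
    * assert (Hkl : (k <= l)%nat).
      { apply Nat.nlt_ge; intros H; assert (A := next_m l k H); lia. }
      assert (HM : 0 < M ^ s k) by (apply bound_pow_pos, M_ge).
      apply Rle_trans with (M ^ s k * height k).
      -- apply Rmult_le_compat; try lra;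
           [apply run_le_pow; auto using abs_weight_pos | apply height_anti, Hkl].
      -- apply Req_le; unfold height; field; lra.
  + apply LimSup_seq_pos with 1; [lra|]; intros n0.
    destruct (Hbig x y Hxy n0) as [k [Hk Hd]].
    assert (HNk := N_ge k); assert (Hrk := r_ge k).
    exists (r k); split; [lia|].
    apply Rle_trans with
      (2 := iter_shift_dist_ge (r k) (z x) (z y) (m k - Z.of_nat (r k))).
    replace (m k - Z.of_nat (r k) + Z.of_nat (r k))%Z with (m k) by lia.
    rewrite Hd.
    (* The height is the exact inverse of the guaranteed amplification, whence the bound 1. *)
    apply Rle_trans with ((INR (N k) + 1) * M ^ s k * height k).
    * apply Req_le; symmetry; apply Rinv_r, Rgt_not_eq, height_denom_pos.
    * apply Rmult_le_compat_r; [apply Rlt_le, height_pos | apply large].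
Qed.

End Scrambled.

(** * Recursive choice of the stages, and the equivalence *)

Lemma runs_small_large_chaotic :
  (forall r, 0 <= r -> exists c : K, abs c = r) ->
  (forall eps, 0 < eps -> forall n0, exists n, (n0 <= n)%nat /\
     run a (- Z.of_nat n) n < eps) ->
  (forall C, exists i n, C < run a i n) ->
  li_yorke_chaotic (c0_metric K) (weighted_backward_shift w hw).
Proof.
intros Hsurj Hinf Hsup.
pose proof hw as [M0 HM0].
set (M := Rmax M0 2).
assert (M_ge : 2 <= M) by apply Rmax_r.
assert (a_le : forall i, a i <= M)
  by (intros i; apply Rle_trans with (1 := HM0 i), Rmax_l).
destruct (functional_choice (fun N (t : nat * Z * nat) =>
  let '(s, m, r) := t in
  ((N <= s)%nat /\ (N <= r)%nat /\ (Z.of_nat N < Z.abs m)%Z) /\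
  (forall j, (Z.abs j <= Z.of_nat N)%Z ->
     run a (j - Z.of_nat s) s <= / (INR N + 1)) /\
  (INR N + 1) * M ^ s <= run a (m - Z.of_nat r) r)) as [t Ht].
{ intros N.
  destruct (run_small_large a abs_weight_pos M M_ge a_le N Hinf Hsup)
    as [s [m [r H]]].
  exists (s, m, r); exact H. }
set (s := fun N => fst (fst (t N))); set (m := fun N => snd (fst (t N))).
set (r := fun N => snd (t N)).
assert (Hs : forall N, (N <= s N)%nat /\ (N <= r N)%nat /\
  (Z.of_nat N < Z.abs (m N))%Z /\
  (forall j, (Z.abs j <= Z.of_nat N)%Z ->
     run a (j - Z.of_nat (s N)) (s N) <= / (INR N + 1)) /\
  (INR N + 1) * M ^ s N <= run a (m N - Z.of_nat (r N)) (r N)).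
{ intros N; assert (H := Ht N); unfold s, m, r.
  destruct (t N) as [[s' m'] r']; simpl; tauto. }
(* Each new radius covers the previous bump and the previous time [s]; it grows strictly because
   [|m N| > N], which yields [k <= N k]. *)
set (N := fun k => Nat.iter k (fun N => Nat.max (Z.to_nat (Z.abs (m N))) (s N)) 0%nat).
assert (HS : forall k, N (S k) = Nat.max (Z.to_nat (Z.abs (m (N k)))) (s (N k)))
  by reflexivity.
assert (Hlt : forall k, (N k < N (S k))%nat).
{ intros k; rewrite HS; destruct (Hs (N k)) as [_ [_ [H _]]]; lia. }
assert (Hmono : forall k l, (k < l)%nat -> (N (S k) <= N l)%nat).
{ intros k l H; induction H as [|l _ IH]; [reflexivity|].
  assert (A := Hlt l); lia. }
apply (bumps_chaotic M M_ge a_le Hsurj N (fun k => s (N k)) (fun k => r (N k))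
  (fun k => m (N k))); try (intros k; apply Hs).
- induction k as [|k IH]; [lia|]; assert (A := Hlt k); lia.
- intros k l H; assert (A := Hmono k l H); rewrite HS in A; lia.
- intros k l H; assert (A := Hmono k l H); rewrite HS in A; lia.
Qed.

End Shift.

Theorem corollary5 (K : AbsRing) (hK : K = R_AbsRing \/ K = C_AbsRing)
  (w : Z -> K) (hw : bounded_family w) (hw0 : forall n : Z, w n <> zero) :
  li_yorke_chaotic (c0_metric K) (weighted_backward_shift w hw) <->
  (LimInf_seq (fun n : nat => abs (weight_prod w (- Z.of_nat n) (-1))) = 0 /\
   Lub_Rbar (fun r : R => exists i j : Z,
     (i <= j)%Z /\ r = abs (weight_prod w i j)) = p_infty).
Proof.
assert (Hmul := scalar_abs_multiplicative K hK).
rewrite (weight_prod_liminf_0 Hmul), (weight_prod_sup_infinite Hmul).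
split.
- intros [S [HS Hchaos]].
  destruct (not_countable_two_points S HS) as [x [y [Hx [Hy Hxy]]]].
  destruct (Hchaos x y Hx Hy Hxy) as [Hinf Hsup].
  assert (Hprox := proj1 (LimInf_seq_eq_0 _
    (fun n => Rge_le _ _ (c0_dist_pos _ _))) Hinf).
  split.
  + exact (proximal_runs_small Hmul w hw hw0 x y Hxy Hprox).
  (* A bound [C] on all runs would make the pair asymptotic, against its positive upper limit. *)
  + intros C; apply NNPP; intros Hno.
    apply LimSup_seq_eventually_le with (2 := Hsup).
    apply (bounded_runs_asymptotic Hmul w hw hw0 x y C); [|exact Hprox].
    intros i n; apply Rnot_lt_le; intros H; apply Hno; exists i, n; exact H.
- intros [Hinf Hsup].
  apply runs_small_large_chaotic; auto using scalar_abs_surj.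
Qed.
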